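(* Let $\mathcal{G}$ be a minimally rigid graph on $n$ vertices that is constructed from the single edge $v_1v_2$ by a sequence of Henneberg 1-steps $m_1,\dots,m_{n-2}$, where $m_l=(i_l,j_l,n_l)$ means that step $l$ adds the new vertex $v_{n_l}$ and connects it to the previously constructed vertices $v_{i_l},v_{j_l}$. Fix a generic labelling $\lambda$ of $\mathcal{G}$ and let $\mathcal F$ be the set of normalized realizations of $\mathcal{G}$ compatible with $\lambda$. Then, as permutation groups on $\mathcal F$, \[ \operatorname{Gal}(\mathcal{G}) \cong \{ g \in \operatorname{Sym}(\mathcal F) : \forall l=1,\dots, n-2,\ \forall \rho, \rho' \in \mathcal F,\ a_{i_lj_ln_l}(\rho) = a_{i_lj_ln_l}(\rho') \implies a_{i_lj_ln_l}(g \rho) = a_{i_lj_ln_l}(g \rho')\}. \]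
   Context: A graph $(V,E)$ is minimally rigid if $|E|=2|V|-3$ and every subgraph $(V',E')$ satisfies $|E'|\le 2|V'|-3$. A labelling is a map $\lambda\colon E\to\mathbb C$; a realization is a map $\rho\colon V\to\mathbb C^2$, compatible with $\lambda$ if $\lambda(\{u,v\})=(x_u-x_v)^2+(y_u-y_v)^2$ for every edge $\{u,v\}$, where $\rho(u)=(x_u,y_u)$, $\rho(v)=(x_v,y_v)$. A labelling is generic if $\lambda(v_1v_2)=1$ and the set $\Lambda$ of all other labels is algebraically independent over $\mathbb Q$. A realization is normalized if $\rho(v_1)=(0,0)$, $\rho(v_2)=(1,0)$. With $\mathbb K=\mathbb Q(\Lambda)$ and $\mathbb E=\mathbb K(C)$, where $C$ is the set of all vertex coordinates of all normalized compatible realizations, $\operatorname{Gal}(\mathcal{G}):=\operatorname{Gal}(\mathbb E/\mathbb K)$, which acts on $\mathcal F$ by applying field automorphisms coordinatewise, $\sigma(\rho)(v)=\sigma(\rho(v))$, and is regarded as a permutation group on $\mathcal F$. For complex points $p_k=(x_k,y_k)$ the signed area is $a_{p_1p_2p_3}=\tfrac12\big((x_2-x_3)(y_1-y_3)-(x_1-x_3)(y_2-y_3)\big)$, and $a_{ijk}(\rho):=a_{\rho(v_i)\rho(v_j)\rho(v_k)}$. *)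

(* Defs.v *)
From HB Require Import structures.
From mathcomp Require Import all_boot all_order all_algebra.
From mathcomp Require Import boolp mpoly.

Set Implicit Arguments.
Unset Strict Implicit.
Unset Printing Implicit Defensive.

Import GRing.Theory Num.Theory.

Local Open Scope ring_scope.

Record graph (V : finType) := Graph {
  edges : {set {set V}};
  edges_card2 : forall e, e \in edges -> #|e| = 2%N }.

(* Subgraphs with fewer than two vertices are excluded: for them the bound
   2|V'| - 3 would be negative. *)
Definition minimally_rigid (V : finType) (G : graph V) : Prop :=
  (#|edges G| + 3 = 2 * #|V|)%N /\
  forall (V' : {set V}) (E' : {set {set V}}),
    E' \subset edges G -> (forall e, e \in E' -> e \subset V') ->
    (2 <= #|V'|)%N -> (#|E'| + 3 <= 2 * #|V'|)%N.

(* henneberg1 v1 v2 m W E : the graph (W, E) arises from the single edge v1v2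
   by the steps m; a step (i, j, k) adds the new vertex k, joined to i, j. *)
Inductive henneberg1 (V : finType) (v1 v2 : V) :
    seq (V * V * V) -> {set V} -> {set {set V}} -> Prop :=
| Henneberg_edge :
    v1 != v2 -> henneberg1 v1 v2 [::] [set v1; v2] [set [set v1; v2]]
| Henneberg_step m W E i j k :
    henneberg1 v1 v2 m W E ->
    i \in W -> j \in W -> i != j -> k \notin W ->
    henneberg1 v1 v2 (rcons m (i, j, k))
      (k |: W) ([set i; k] |: ([set j; k] |: E)).

(* Independence of the family (f a)_{a in A} over Q; in particular f is
   injective on A. *)
Definition alg_independent (C : numFieldType) (T : finType) (A : {set T})
    (f : T -> C) : Prop :=
  forall p : {mpoly rat[#|A|]},
    (map_mpoly ratr p).@[fun i => f (enum_val i)] = 0 -> p = 0.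

Section GeneratedSubfield.
Variables (C : fieldType) (S : C -> Prop).

(* The smallest subfield of C containing S: when C has characteristic 0 this
   is Q(S), Q being the prime field. *)
Definition genfield : {pred C} := fun x =>
  `[< forall P : {pred C},
        GRing.divring_closed P -> (forall s, S s -> s \in P) -> x \in P >].

Lemma genfieldP x :
  (x \in genfield) <->
  (forall P : {pred C},
     GRing.divring_closed P -> (forall s, S s -> s \in P) -> x \in P).
Proof. by split=> [/asboolP|h]; last exact/asboolP. Qed.

Lemma genfield_divring_closed : GRing.divring_closed genfield.
Proof.
split=> [|x y|x y].
- by apply/genfieldP => P [].
- move=> /genfieldP hx /genfieldP hy; apply/genfieldP => P hP hS.
  by case: (hP) => _ hB _; apply: hB; [apply: hx | apply: hy].
- move=> /genfieldP hx /genfieldP hy; apply/genfieldP => P hP hS.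
  by case: (hP) => _ _ hM; apply: hM; [apply: hx | apply: hy].
Qed.

HB.instance Definition _ :=
  GRing.isDivringClosed.Build C genfield genfield_divring_closed.

Lemma mem_genfield s : S s -> s \in genfield.
Proof. by move=> hs; apply/genfieldP => P _; apply. Qed.

Record genfield_type :=
  GenField { genfield_val :> C; genfield_valP : genfield_val \in genfield }.

HB.instance Definition _ := [isSub for genfield_val].
HB.instance Definition _ := [Choice of genfield_type by <:].
HB.instance Definition _ :=
  [SubChoice_isSubIntegralDomain of genfield_type by <:].
HB.instance Definition _ :=
  [SubIntegralDomain_isSubField of genfield_type by <:].

End GeneratedSubfield.

Section Realizations.
Variables (C : numFieldType) (V : finType) (G : graph V) (v1 v2 : V).

Definition sqdist (p q : C * C) : C := (p.1 - q.1) ^+ 2 + (p.2 - q.2) ^+ 2.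

Definition signed_area (p1 p2 p3 : C * C) : C :=
  2^-1 * ((p2.1 - p3.1) * (p1.2 - p3.2) - (p1.1 - p3.1) * (p2.2 - p3.2)).

Definition area (i j k : V) (rho : {ffun V -> C * C}) : C :=
  signed_area (rho i) (rho j) (rho k).

(* A labelling is given by a total function on {set V}; only its values on
   edges G are ever used. *)
Variable lam : {set V} -> C.

Definition other_edges : {set {set V}} := edges G :\ [set v1; v2].

Definition generic_labelling : Prop :=
  lam [set v1; v2] = 1 /\ alg_independent other_edges lam.

Definition compatible (rho : {ffun V -> C * C}) : bool :=
  [forall u, forall v,
    ([set u; v] \in edges G) ==>
      (lam [set u; v] == sqdist (rho u) (rho v))].

Definition normalized (rho : {ffun V -> C * C}) : bool :=
  (rho v1 == (0, 0)) && (rho v2 == (1, 0)).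

Record nreal := NReal {
  nreal_val :> {ffun V -> C * C};
  nreal_valP : compatible nreal_val && normalized nreal_val }.

HB.instance Definition _ := [isSub for nreal_val].
HB.instance Definition _ := [Choice of nreal by <:].

Definition label_set (x : C) : Prop := exists2 e, e \in other_edges & x = lam e.

Definition baseK : {pred C} := genfield label_set.

Definition coord_set (x : C) : Prop :=
  exists (rho : nreal) (v : V), x = (rho v).1 \/ x = (rho v).2.

Definition extE : Type := genfield_type (fun x => x \in baseK \/ coord_set x).

HB.instance Definition _ := GRing.SubField.on extE.

Record gal := Gal {
  gal_map :> {rmorphism extE -> extE};
  gal_bij : bijective gal_map;
  gal_fix : forall x : extE, genfield_val x \in baseK -> gal_map x = x }.

Definition gal_comp (s t : gal) : gal :=
  @Gal (GRing.RMorphism.clone _ _ (s \o t) _) (bij_comp (gal_bij s) (gal_bij t))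
    (fun x hx => etrans (f_equal s (gal_fix t hx)) (gal_fix s hx)).

Definition coord1 (rho : nreal) (v : V) : extE :=
  GenField (mem_genfield
    (or_intror (ex_intro _ rho (ex_intro _ v (or_introl erefl))))).

Definition coord2 (rho : nreal) (v : V) : extE :=
  GenField (mem_genfield
    (or_intror (ex_intro _ rho (ex_intro _ v (or_intror erefl))))).

Definition gal_act_fun (s : gal) (rho : nreal) : {ffun V -> C * C} :=
  [ffun v => (genfield_val (s (coord1 rho v)),
              genfield_val (s (coord2 rho v)))].

Lemma gal_act_subproof (s : gal) (rho : nreal) :
  compatible (gal_act_fun s rho) && normalized (gal_act_fun s rho).
Proof.
have /andP[/forallP cr /andP[/eqP r1 /eqP r2]] := nreal_valP rho.
have nrm : normalized (gal_act_fun s rho).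
  have c11 : coord1 rho v1 = 0 by apply: val_inj; rewrite /= r1.
  have c12 : coord2 rho v1 = 0 by apply: val_inj; rewrite /= r1.
  have c21 : coord1 rho v2 = 1 by apply: val_inj; rewrite /= r2.
  have c22 : coord2 rho v2 = 0 by apply: val_inj; rewrite /= r2.
  by rewrite /normalized !ffunE c11 c12 c21 c22 rmorph0 rmorph1 !eqxx.
rewrite nrm andbT; apply/forallP => u; apply/forallP => v; apply/implyP => euv.
have /eqP hl := implyP (forallP (cr u) v) euv.
have lamK : lam [set u; v] \in baseK.
  have [e12|ne12] := eqVneq [set u; v] [set v1; v2]; last first.
    by apply: mem_genfield; exists [set u; v]; rewrite // in_setD1 ne12.
  have := cr v1 => /forallP /(_ v2) /implyP; rewrite -e12 => /(_ euv) /eqP ->.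
  by rewrite r1 r2 /sqdist /= subrr sub0r sqrrN expr1n expr0n addr0 rpred1.
have lamE : genfield_val ((coord1 rho u - coord1 rho v) ^+ 2 +
    (coord2 rho u - coord2 rho v) ^+ 2 : extE) = lam [set u; v].
  by rewrite hl /sqdist !expr2.
move: lamK; rewrite -lamE => /(gal_fix s) <-.
by rewrite rmorphD !rmorphXn !rmorphB /gal_act_fun !ffunE /sqdist !expr2.
Qed.

Definition gal_act (s : gal) (rho : nreal) : nreal :=
  NReal (gal_act_subproof s rho).

End Realizations.

(* Main.v *)
(** A normalized realization is determined by the signed areas of the triangles
    created by the steps. Let [d] be the squared distance of the two old vertices
    in a step and [la], [mu] the two new labels. Heron's formula reads
    [16 a ^ 2 = - (la - (s + t) ^ 2) (la - (s - t) ^ 2)], where [s ^ 2 = d] and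
    [t ^ 2 = mu], and flipping the new vertex replaces [a] by [- a]. The field is
    therefore a tower in which a step adjoins square roots of the Heron
    polynomials of the finitely many values of [d]. By genericity [la] is
    transcendental over the algebraic closure [A] of the field of all other
    labels, and for distinct [d] the roots [(s +- t) ^ 2] are distinct elements
    of [A]; hence no nonempty product of the areas with distinct [d] lies in
    [A(la)], and by Kummer theory the signs of the new square roots can be
    prescribed independently. A permutation of the realizations that respects
    equality of areas commutes with the flips, so it prescribes these signs
    consistently, and the corresponding automorphism is built step by step. *)

Require Import Defs.
From HB Require Import structures.
From mathcomp Require Import all_boot all_order all_algebra.
From mathcomp Require Import boolp mpoly reals complex ring.

Set Implicit Arguments.
Unset Strict Implicit.
Unset Printing Implicit Defensive.

Import GRing.Theory Num.Theory.

Local Open Scope ring_scope.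

(** * Partial isomorphisms of a field *)

Section PartialIso.
Variable C : fieldType.
Implicit Types (Phi : C -> C -> Prop) (P : {pred C}).

(* An isomorphism between two subfields of [C], given by its graph. *)
Record field_graph Phi : Prop := FieldGraph {
  fgraph1 : Phi 1 1;
  fgraphB : forall x y x' y', Phi x y -> Phi x' y' -> Phi (x - x') (y - y');
  fgraphM : forall x y x' y', Phi x y -> Phi x' y' -> Phi (x * x') (y * y');
  fgraphV : forall x y, Phi x y -> Phi x^-1 y^-1;
  fgraph_eq0 : forall y, Phi 0 y -> y = 0 }.

Section Theory.
Variables (Phi : C -> C -> Prop) (hPhi : field_graph Phi).

Lemma fgraph0 : Phi 0 0.
Proof. by have := fgraphB hPhi (fgraph1 hPhi) (fgraph1 hPhi); rewrite !subrr. Qed.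

Lemma fgraphN x y : Phi x y -> Phi (- x) (- y).
Proof. by move=> h; have := fgraphB hPhi fgraph0 h; rewrite !sub0r. Qed.

Lemma fgraphD x y x' y' : Phi x y -> Phi x' y' -> Phi (x + x') (y + y').
Proof.
move=> h h'; have := fgraphB hPhi h (fgraphN h').
by rewrite !opprK.
Qed.

Lemma fgraphX x y n : Phi x y -> Phi (x ^+ n) (y ^+ n).
Proof.
move=> h; elim: n => [|n IH]; first exact: fgraph1 hPhi.
by rewrite !exprS; apply: fgraphM.
Qed.

Lemma fgraph_nat n : Phi n%:R n%:R.
Proof.
elim: n => [|n IH]; first exact: fgraph0.
by rewrite -natr1; apply: fgraphD => //; apply: fgraph1.
Qed.

Lemma fgraph_div x y x' y' : Phi x y -> Phi x' y' -> Phi (x / x') (y / y').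
Proof. by move=> h h'; apply: fgraphM => //; apply: fgraphV. Qed.

Lemma fgraph_fun x y y' : Phi x y -> Phi x y' -> y = y'.
Proof.
move=> h h'; apply/eqP; rewrite -subr_eq0; apply/eqP.
by apply: (fgraph_eq0 hPhi); have := fgraphB hPhi h h'; rewrite subrr.
Qed.

Lemma fgraph_eq0r x : Phi x 0 -> x = 0.
Proof.
move=> h; apply/eqP/negPn/negP => x0.
have := fgraph_div h h; rewrite mulfV // mul0r => h1.
by have /eqP := fgraph_fun h1 (fgraph1 hPhi); rewrite eq_sym oner_eq0.
Qed.

Lemma fgraph_inj x x' y : Phi x y -> Phi x' y -> x = x'.
Proof.
move=> h h'; apply/eqP; rewrite -subr_eq0; apply/eqP.
by apply: fgraph_eq0r; have := fgraphB hPhi h h'; rewrite subrr.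
Qed.

Lemma field_graph_sym : field_graph (fun x y => Phi y x).
Proof.
split.
- exact: fgraph1 hPhi.
- by move=> x y x' y' h h'; apply: fgraphB.
- by move=> x y x' y' h h'; apply: fgraphM.
- by move=> x y h; apply: fgraphV.
- exact: fgraph_eq0r.
Qed.

End Theory.

Definition fdom Phi : {pred C} := fun x => `[< exists y, Phi x y >].

Lemma fdomP Phi x : reflect (exists y, Phi x y) (x \in fdom Phi).
Proof. exact: asboolP. Qed.

(* Norms [(a + b x) (a - b x) = a ^ 2 - b ^ 2 x ^ 2] give the inverses. *)
Lemma field_graph_sqrt Phi x y :
  field_graph Phi -> Phi (x ^+ 2) (y ^+ 2) -> x \notin fdom Phi ->
  field_graph (fun u w => exists a a' b b',
    [/\ Phi a a', Phi b b', u = a + b * x & w = a' + b' * y]).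
Proof.
move=> h hxy xN.
(* [1] and [x] are linearly independent over the domain of [Phi]. *)
have bx0 a a' b b' : Phi a a' -> Phi b b' -> a + b * x = 0 -> a = 0 /\ b = 0.
  move=> ha hb /eqP; rewrite addr_eq0 => /eqP e.
  have [b0|b0] := eqVneq b 0; first by rewrite e b0 mul0r oppr0.
  case/negP: xN; apply/fdomP; exists (- a' / b').
  suff -> : x = - a / b by apply: fgraph_div => //; apply: fgraphN.
  by rewrite e opprK mulrC mulKf.
split.
- exists 1, 1, 0, 0; rewrite !mul0r !addr0; split=> //; first exact: fgraph1.
  exact: fgraph0.
- move=> _ _ _ _ [a [a' [b [b' [ha hb -> ->]]]]] [c [c' [d [d' [hc hd -> ->]]]]].
  exists (a - c), (a' - c'), (b - d), (b' - d').
  by split; [exact: fgraphB | exact: fgraphB | ring | ring].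
- move=> _ _ _ _ [a [a' [b [b' [ha hb -> ->]]]]] [c [c' [d [d' [hc hd -> ->]]]]].
  exists (a * c + b * d * x ^+ 2), (a' * c' + b' * d' * y ^+ 2).
  exists (a * d + b * c), (a' * d' + b' * c').
  by split; [| | ring | ring]; do ?[apply: fgraphD => //]; do ?[apply: fgraphM => //].
- move=> _ _ [a [a' [b [b' [ha hb -> ->]]]]].
  pose N := a ^+ 2 - b ^+ 2 * x ^+ 2; pose N' := a' ^+ 2 - b' ^+ 2 * y ^+ 2.
  have hN : Phi N N'.
    by apply: fgraphB => //; [|apply: fgraphM => //]; apply: fgraphX.
  have eN : N = (a + b * x) * (a - b * x) by rewrite /N; ring.
  have eN' : N' = (a' + b' * y) * (a' - b' * y) by rewrite /N'; ring.
  (* Inversion is total with [0^-1 = 0], so zero must be matched with zero. *)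
  have [N0|N0] := eqVneq N 0.
    have [a0 b0] : a = 0 /\ b = 0.
      move/eqP: N0; rewrite eN mulf_eq0 => /orP[] /eqP; first exact: bx0 ha hb.
      rewrite -mulNr => e; have [-> /eqP] := bx0 _ _ _ _ ha (fgraphN h hb) e.
      by rewrite oppr_eq0 => /eqP.
    have a'0 : a' = 0 by apply: (fgraph_eq0 h); rewrite -a0.
    have b'0 : b' = 0 by apply: (fgraph_eq0 h); rewrite -b0.
    exists 0, 0, 0, 0; split; try exact: fgraph0.
    + by rewrite a0 b0 mul0r addr0 invr0.
    + by rewrite a'0 b'0 mul0r addr0 invr0.
  have N'0 : N' != 0.
    by apply: contraNneq N0 => e; apply/eqP/(fgraph_eq0r h); rewrite -e.
  exists (a / N), (a' / N'), (- b / N), (- b' / N'); split.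
  + exact: fgraph_div.
  + by apply: fgraph_div => //; apply: fgraphN.
  + apply: (mulIf N0); rewrite mulrDl mulfVK // mulrAC mulfVK // {1}eN.
    by rewrite mulKf ?mulNr //; apply: contraNneq N0; rewrite eN => ->; rewrite mul0r.
  + apply: (mulIf N'0); rewrite mulrDl mulfVK // mulrAC mulfVK // {1}eN'.
    by rewrite mulKf ?mulNr //; apply: contraNneq N'0; rewrite eN' => ->; rewrite mul0r.
- move=> w [a [a' [b [b' [ha hb e ->]]]]].
  have [a0 b0] := bx0 _ _ _ _ ha hb (esym e).
  rewrite a0 b0 in ha hb.
  by rewrite (fgraph_eq0 h ha) (fgraph_eq0 h hb) mul0r addr0.
Qed.

(* If [2 a b x] and [x ^ 2] lie in a field without [x] then [a b = 0]; hence
   independence modulo squares over [L] passes to [L(x)]. *)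
Lemma field_graph_kummer (s : seq (C * C)) Phi :
  (2%:R : C) != 0 -> field_graph Phi ->
  (forall z, z \in s -> Phi (z.1 ^+ 2) (z.2 ^+ 2)) ->
  (forall t, subseq t (unzip1 s) -> t != [::] -> \prod_(x <- t) x \notin fdom Phi) ->
  exists Psi : C -> C -> Prop,
    [/\ field_graph Psi, forall x y, Phi x y -> Psi x y,
        forall z, z \in s -> Psi z.1 z.2 &
        forall P : divringClosed C, {subset fdom Phi <= P} ->
          {subset unzip1 s <= P} -> {subset fdom Psi <= P}].
Proof.
move=> two0; elim: s Phi => [|[x y] s IH] Phi h hs ht.
  by exists Phi; split.
have xN : x \notin fdom Phi.
  have := ht [:: x]; rewrite big_seq1; apply=> //.
  by rewrite /= eqxx sub0seq.
have hxy : Phi (x ^+ 2) (y ^+ 2) by apply: (hs (x, y)); rewrite mem_head.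
have h' := field_graph_sqrt h hxy xN; set Phi' := (fun u w => _) in h'.
have sub u w : Phi u w -> Phi' u w.
  move=> huw; exists u, w, 0, 0; rewrite !mul0r !addr0.
  by split=> //; apply: fgraph0.
have [] := IH Phi' h'.
- by move=> z zs; apply: sub; apply: hs; rewrite inE zs orbT.
- move=> t ts t0; apply/negP => /fdomP[w [a [a' [b [b' [ha hb e _]]]]]].
  have sq : exists r, Phi ((\prod_(u <- t) u) ^+ 2) r.
    have : forall u, u \in t -> exists r, Phi (u ^+ 2) r.
      move=> u /(mem_subseq ts) /mapP[z zs ->]; exists (z.2 ^+ 2).
      by apply: hs; rewrite inE zs orbT.
    elim: (t) => [|u t' IHt] hu.
      by rewrite big_nil expr1n; exists 1; apply: fgraph1.
    have [r hr] := hu u (mem_head _ _).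
    have [|r' hr'] := IHt; first by move=> v vt; apply: hu; rewrite inE vt orbT.
    by exists (r * r'); rewrite big_cons exprMn; apply: fgraphM.
  have [r hr] := sq.
  have [b0|b0] := eqVneq b 0.
    case/negP: (ht t (subseq_trans ts (subseq_cons _ _)) t0).
    by rewrite e b0 mul0r addr0; apply/fdomP; exists a'.
  (* Here [x] times the product is [b * x ^+ 2], which is in the domain, against independence for
     [x :: t]. *)
  have [a0|a0] := eqVneq a 0.
    have := ht (x :: t) _ isT; rewrite /= eqxx => /(_ ts) /negP; apply.
    rewrite big_cons e a0 add0r mulrCA -expr2; apply/fdomP.
    by exists (b' * y ^+ 2); apply: fgraphM.
  case/negP: xN; apply/fdomP.
  exists ((r - a' ^+ 2 - b' ^+ 2 * y ^+ 2) / (a' * b' *+ 2)).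
  have -> : x = ((\prod_(u <- t) u) ^+ 2 - a ^+ 2 - b ^+ 2 * x ^+ 2) / (a * b *+ 2).
    rewrite e; have ab0 : a * b *+ 2 != 0.
      by rewrite -mulr_natl !mulf_neq0.
    by apply: (mulIf ab0); rewrite mulfVK //; ring.
  apply: fgraph_div => //.
    do 2?[apply: fgraphB => //]; first exact: fgraphX.
    by apply: fgraphM => //; apply: fgraphX.
  by rewrite !mulr2n; apply: fgraphD => //; apply: fgraphM.
move=> Psi [hPsi1 hPsi2 hPsi3 hPsi4]; exists Psi; split=> //.
- by move=> u w /sub; apply: hPsi2.
- move=> z; rewrite inE => /orP[/eqP->|]; last exact: hPsi3.
  apply: hPsi2; exists 0, 0, 1, 1; rewrite !mul1r !add0r.
  by split=> //; [apply: fgraph0 | apply: fgraph1].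
- move=> P sP sxP; apply: hPsi4 => //; last first.
    by move=> u us; apply: sxP; rewrite inE us orbT.
  move=> u /fdomP[w [a [a' [b [b' [ha hb -> _]]]]]].
  have aP : a \in P by apply: sP; apply/fdomP; exists a'.
  have bP : b \in P by apply: sP; apply/fdomP; exists b'.
  have xP : x \in P by apply: sxP; rewrite mem_head.
  exact: rpredD aP (rpredM bP xP).
Qed.

End PartialIso.

(** * Relative algebraic closure and simple extensions *)

Section AlgebraicClosure.
Variables (C : fieldType) (S : C -> Prop).

Definition algclosure : {pred C} := fun x =>
  `[< algebraicOver (@genfield_val C S) x >].

Lemma algclosureP x :
  reflect (algebraicOver (val : genfield_type S -> C) x) (x \in algclosure).
Proof. exact: asboolP. Qed.

Lemma algclosure_divring_closed : GRing.divring_closed algclosure.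
Proof.
split=> [|x y /algclosureP hx /algclosureP hy|x y /algclosureP hx /algclosureP hy];
  apply/algclosureP.
- exact: algebraic1.
- exact: algebraic_sub.
- exact: algebraic_div.
Qed.

HB.instance Definition _ :=
  GRing.isDivringClosed.Build C algclosure algclosure_divring_closed.

Lemma genfield_algclosure x : x \in genfield S -> x \in algclosure.
Proof. by move=> hx; apply/algclosureP; apply: (algebraic_id _ (GenField hx)). Qed.

Lemma mem_algclosure x : S x -> x \in algclosure.
Proof. by move=> hx; apply: genfield_algclosure; apply: mem_genfield. Qed.

(** Over a field, algebraic means integral, and a root of a nonzero polynomial with integral
    coefficients is integral. *)
Lemma root_algclosure (p : {poly C}) x :
  p \is a polyOver algclosure -> p != 0 -> root p x -> x \in algclosure.
Proof.
move=> /polyOverP hp p0 px; apply/algclosureP/integral_algebraic.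
apply: (integral_root p0 px); apply/integral_poly => i.
by apply/integral_algebraic/algclosureP/hp.
Qed.

Lemma sqrt_algclosure x : x ^+ 2 \in algclosure -> x \in algclosure.
Proof.
move=> hx; apply: (@root_algclosure ('X^2 - (x ^+ 2)%:P)).
- by rewrite rpredB ?rpredX ?polyOverX ?polyOverC.
- by rewrite -size_poly_eq0 size_XnsubC.
- by rewrite rootE !hornerE subrr.
Qed.

End AlgebraicClosure.

Section SimpleExtension.
Variables (C : fieldType) (A : divringClosed C) (x : C).

Definition ratfun : {pred C} := fun z =>
  `[< exists f g : {poly C}, [/\ f \is a polyOver A, g \is a polyOver A,
        g.[x] != 0 & z = f.[x] / g.[x]] >].

Lemma ratfunP z : reflect (exists f g : {poly C},
  [/\ f \is a polyOver A, g \is a polyOver A, g.[x] != 0 & z = f.[x] / g.[x]])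
  (z \in ratfun).
Proof. exact: asboolP. Qed.

Lemma ratfun_divring_closed : GRing.divring_closed ratfun.
Proof.
split=> [|_ _ /ratfunP[f [g [fA gA g0 ->]]] /ratfunP[f' [g' [f'A g'A g'0 ->]]]
         |_ _ /ratfunP[f [g [fA gA g0 ->]]] /ratfunP[f' [g' [f'A g'A g'0 ->]]]];
  apply/ratfunP.
- exists 1, 1; rewrite !hornerE oner_eq0 ?divr1 ?invr1 ?mulr1 ?mul0r.
  by split=> //; apply: rpred1.
- exists (f * g' - f' * g), (g * g'); rewrite !hornerE mulf_neq0 //.
  split=> //; first by rewrite rpredB ?rpredM.
    by rewrite rpredM.
  by field; rewrite ?g0 ?g'0.
- have [f'0|f'0] := eqVneq f'.[x] 0.
    exists 0, 1; rewrite !hornerE f'0 !(mul0r, invr0, mulr0) oner_eq0.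
    by split=> //; [apply: rpred0 | apply: rpred1].
  exists (f * g'), (g * f'); rewrite !hornerE mulf_neq0 //.
  split=> //; try by rewrite rpredM.
  by field; rewrite ?g0 ?f'0 ?g'0.
Qed.

HB.instance Definition _ :=
  GRing.isDivringClosed.Build C ratfun ratfun_divring_closed.

Lemma ratfun_base z : z \in A -> z \in ratfun.
Proof.
move=> zA; apply/ratfunP; exists z%:P, 1.
rewrite !hornerE oner_eq0 ?divr1 ?invr1 ?mulr1 ?mul0r.
by split; rewrite ?polyOverC ?rpred1.
Qed.

Lemma ratfun_gen : x \in ratfun.
Proof.
apply/ratfunP; exists 'X, 1; rewrite !hornerE oner_eq0 ?divr1 ?invr1 ?mulr1 ?mul0r.
by split; rewrite ?polyOverX ?rpred1.
Qed.

(* A simple root occurs with odd multiplicity, so the product is not a square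
   in the polynomial ring over [A]. *)
Lemma ratfun_nonsquare (c : C) (rs : seq C) z :
  (forall p, p \is a polyOver A -> root p x -> p = 0) ->
  c \in A -> c != 0 -> {subset rs <= A} -> uniq rs -> rs != [::] ->
  z ^+ 2 = c * \prod_(r <- rs) (x - r) -> z \notin ratfun.
Proof.
move=> xtr cA c0 rsA rs_uniq rs0 ez; apply/negP => /ratfunP[f [g [fA gA g0 ef]]].
pose P : {poly C} := \prod_(r <- rs) ('X - r%:P).
have PA : P \is a polyOver A.
  rewrite /P big_seq; apply: rpred_prod => r rrs.
  by rewrite rpredB ?polyOverX ?polyOverC ?rsA.
have P0 : P != 0 by apply: monic_neq0; apply: monic_prod_XsubC.
have Px : P.[x] = \prod_(r <- rs) (x - r).
  by rewrite /P horner_prod; apply: eq_bigr => r _; rewrite !hornerE.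
(* Since [x] is transcendental over [A], the identity between values at [x] lifts to polynomials. *)
have eP : f ^+ 2 = g ^+ 2 * (c%:P * P).
  apply/eqP; rewrite -subr_eq0; apply/eqP; apply: xtr.
    by rewrite rpredB ?rpredM ?rpredX ?polyOverC.
  rewrite rootE hornerD hornerN horner_exp hornerM horner_exp hornerCM Px -ez ef.
  by rewrite expr_div_n mulrCA divff ?expf_neq0 // mulr1 subrr.
have gn0 : g != 0 by apply: contraNneq g0 => ->; rewrite horner0.
have cP0 : c%:P * P != 0 by rewrite mulf_neq0 ?polyC_eq0.
have fn0 : f != 0.
  by have := mulf_neq0 (expf_neq0 2 gn0) cP0; rewrite -eP expf_eq0.
case: rs rs0 rs_uniq @P PA P0 Px eP cP0 {rsA ez} => // r rs _ /andP[rN _].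
move=> P PA P0 Px eP cP0.
have := congr1 (mup r) eP; rewrite !expr2 !mupM ?mulf_neq0 ?polyC_eq0 //.
rewrite (mupNroot (q := c%:P)) ?rootC // mu_prod_XsubC /= eqxx.
rewrite (count_memPn rN) !addnn addn0 add0n addn1 => /(congr1 odd).
by rewrite /= !odd_double.
Qed.

End SimpleExtension.

(** * Algebraically independent labels *)

(** Two embeddings of a domain identify the fraction fields of their images. Applied to evaluations
    at two points, this turns a substitution of labels into a partial isomorphism. *)
Lemma field_graph_frac (D : idomainType) (C : fieldType)
    (f g : {rmorphism D -> C}) :
  (forall p, f p = 0 -> p = 0) -> (forall p, g p = 0 -> p = 0) ->
  field_graph (fun x y => exists p q,
    [/\ q != 0, x = f p / f q & y = g p / g q]).
Proof.
move=> fI gI.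
have fn0 q : q != 0 -> f q != 0 by apply: contraNneq => /fI->.
have gn0 q : q != 0 -> g q != 0 by apply: contraNneq => /gI->.
split.
- by exists 1, 1; rewrite !rmorph1 oner_neq0 divr1.
- move=> _ _ _ _ [p [q [q0 -> ->]]] [p' [q' [q'0 -> ->]]].
  exists (p * q' - p' * q), (q * q'); rewrite mulf_neq0 // !rmorphB !rmorphM.
  by split=> //; field; rewrite ?fn0 ?gn0.
- move=> _ _ _ _ [p [q [q0 -> ->]]] [p' [q' [q'0 -> ->]]].
  exists (p * p'), (q * q'); rewrite mulf_neq0 // !rmorphM.
  by split=> //; field; rewrite ?fn0 ?gn0.
- move=> _ _ [p [q [q0 -> ->]]]; have [->|p0] := eqVneq p 0.
    by exists 0, 1; rewrite oner_neq0 !rmorph0 !mul0r invr0.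
  by exists q, p; rewrite !invf_div.
- move=> _ [p [q [q0 e ->]]]; suff -> : p = 0 by rewrite rmorph0 mul0r.
  apply/fI/eqP; move/esym/eqP: e; rewrite mulf_eq0 invr_eq0 => /orP[//|].
  by rewrite (negPf (fn0 _ q0)).
Qed.

Lemma fgraph_horner (C : fieldType) (Phi : C -> C -> Prop) (p : {poly C}) x y :
  field_graph Phi -> (forall i, Phi p`_i p`_i) -> Phi x y -> Phi p.[x] p.[y].
Proof.
move=> h hp hxy; rewrite !horner_coef.
elim/big_ind2: _ => [|a a' b b' ha hb|i _]; first exact: fgraph0.
  exact: fgraphD.
by apply: fgraphM => //; apply: fgraphX.
Qed.

Section Generic.
Variables (C : numFieldType) (T : finType) (A : {set T}) (f : T -> C).
Hypothesis f_indep : alg_independent A f.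

Definition rat_meval (v : 'I_#|A| -> C) : {mpoly rat[#|A|]} -> C :=
  meval v \o map_mpoly ratr.

HB.instance Definition _ v :=
  GRing.RMorphism.copy (rat_meval v) (meval v \o map_mpoly ratr).

Local Notation ev := rat_meval.

(** Serves to transfer algebraic independence to a translated point, rational translations being
    invertible substitutions. *)
Lemma rat_meval_shift (v w : 'I_#|A| -> C) (c : 'I_#|A| -> rat) p :
  (forall i, w i = v i + ratr (c i)) ->
  ev v (p \mPo [tuple 'X_i + (c i)%:MP | i < #|A|]) = ev w p.
Proof.
move=> vw; rewrite /rat_meval /= map_mpoly_comp; last exact: fmorph_inj.
rewrite comp_mpoly_meval; apply: meval_eq => i.
rewrite tnth_map tnth_mktuple vw rmorphD /= map_mpolyX map_mpolyC.
by rewrite mevalD mevalXU mevalC.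
Qed.

(* The substitution [f a := f a + 1] fixes the field generated by the other
   [f b], so a polynomial over that field with root [f a] has the roots
   [f a + k] for all natural numbers [k]. *)
Lemma alg_independent_notin a : a \in A ->
  f a \notin algclosure (fun x => exists2 b, b \in A :\ a & x = f b).
Proof.
move=> aA; apply/negP => /algclosureP[p p0 pa].
pose i0 := enum_rank_in aA a.
pose v i := f (enum_val (i : 'I_#|A|)).
pose w i := v i + (i == i0)%:R.
have evI q : ev v q = 0 -> q = 0 by apply: f_indep.
have ewI q : ev w q = 0 -> q = 0.
  rewrite -(rat_meval_shift (v := v) (c := fun i => (i == i0)%:R)); last first.
    by move=> i; rewrite /w ratr_nat.
  move=> /evI e0; apply: evI.
  (* The translation is undone: the translated polynomial is zero, and its value at [u] is that of
     [q] at [v]. *)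
  pose u i := v i - (i == i0)%:R.
  rewrite -(rat_meval_shift (v := u) (c := fun i => (i == i0)%:R)) ?e0 ?rmorph0 //.
  by move=> i; rewrite /u ratr_nat subrK.
have h := field_graph_frac evI ewI; set Phi := (fun x y => _) in h.
have Phi_ev q : Phi (ev v q) (ev w q).
  by exists q, 1; rewrite oner_neq0 !rmorph1 !divr1.
have evX u i : ev u 'X_i = u i by rewrite /rat_meval /= map_mpolyX mevalXU.
have Phi_gen c : c \in genfield (fun x => exists2 b, b \in A :\ a & x = f b) ->
    Phi c c.
  move/genfieldP => /(_ (fun x => `[< Phi x x >])) hc; apply/asboolP/hc.
    split; first by apply/asboolP; apply: fgraph1.
    - by move=> x y /asboolP hx /asboolP hy; apply/asboolP; apply: fgraphB.
    - by move=> x y /asboolP hx /asboolP hy; apply/asboolP; apply: fgraph_div.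
  move=> _ [b /setD1P[ba bA] ->]; apply/asboolP.
  have := Phi_ev 'X_(enum_rank_in aA b); rewrite !evX /w /v enum_rankK_in //.
  case: eqP => [e|_]; last by rewrite addr0.
  by case/eqP: ba; rewrite -(enum_rankK_in aA bA) e enum_rankK_in.
have Phi_a k : Phi (f a + k%:R) (f a + k.+1%:R).
  have va : v i0 = f a by rewrite /v enum_rankK_in.
  have := Phi_ev 'X_i0; rewrite !evX /w eqxx va => ha.
  rewrite -natr1 [k%:R + 1]addrC addrA; apply: fgraphD => //.
  apply: Phi_gen; exact: rpred_nat.
pose q := map_poly val p : {poly C}.
have q0 : q != 0 by rewrite map_poly_eq0.
have qroot k : q.[f a + k%:R] = 0.
  elim: k => [|k IH]; first by rewrite addr0; apply/eqP.
  apply: (fgraph_eq0 h); rewrite -{1}IH; apply: fgraph_horner => // i.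
  by rewrite coef_map; apply: Phi_gen; apply: genfield_valP.
(* In characteristic 0 the points [f a + k] are distinct, so [q] would have [size q] roots, one more
   than its degree. *)
have := max_poly_roots (rs := [seq f a + k%:R | k <- iota 0 (size q)]) q0.
rewrite size_map size_iota ltnn => contra_roots; suff: false by []; apply: contra_roots.
- by apply/allP => _ /mapP[k _ ->]; apply/eqP.
- rewrite map_inj_uniq ?iota_uniq // => k l /addrI /eqP.
  by rewrite eqr_nat => /eqP.
Qed.

End Generic.

(** * Triangles with prescribed squared distances *)

Section Triangles.
Variable C : numFieldType.
Implicit Types (p q r : C * C) (d la mu a : C).

(** Sixteen times the squared area of a triangle with these squared side lengths. *)
Definition heron d la mu : C := 4%:R * d * la - (d + la - mu) ^+ 2.

(* The third vertex of a triangle over [p, q] with squared distances [la] from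
   [p] and [mu] from [q], and signed area [a]; meaningful only if [p] and [q]
   do not lie on an isotropic line. *)
Definition apex p q la mu a : C * C :=
  let d := sqdist p q in
  let dot := (d + la - mu) / 2%:R in
  (p.1 + ((q.1 - p.1) * dot + (q.2 - p.2) * (2%:R * a)) / d,
   p.2 + ((q.2 - p.2) * dot - (q.1 - p.1) * (2%:R * a)) / d).

Lemma sqdistC p q : sqdist p q = sqdist q p.
Proof. by rewrite /sqdist; ring. Qed.

Lemma heron_area p q r :
  16%:R * signed_area p q r ^+ 2 = heron (sqdist p q) (sqdist p r) (sqdist q r).
Proof. by rewrite /heron /signed_area /sqdist; field. Qed.

Lemma heron_factor s t la :
  heron (s ^+ 2) la (t ^+ 2) = - ((la - (s + t) ^+ 2) * (la - (s - t) ^+ 2)).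
Proof. by rewrite /heron; ring. Qed.

Lemma apexE p q r : sqdist p q != 0 ->
  apex p q (sqdist p r) (sqdist q r) (signed_area p q r) = r.
Proof.
move=> d0; rewrite [RHS]surjective_pairing.
by rewrite /apex /sqdist /signed_area in d0 *; congr (_, _); field.
Qed.

Lemma sqdist_apexl p q la mu a : sqdist p q != 0 ->
  16%:R * a ^+ 2 = heron (sqdist p q) la mu -> sqdist p (apex p q la mu a) = la.
Proof.
move=> d0 ha.
(* The vector [q - p] and its quarter turn both have squared length [d], so the squared distance is
   [(dot ^ 2 + 4 a ^ 2) / d]. *)
transitivity (((sqdist p q + la - mu) ^+ 2 + 16%:R * a ^+ 2) / (4%:R * sqdist p q)).
  by rewrite /apex; move: d0; rewrite /sqdist => d0 /=; field.
by rewrite ha /heron; move: (sqdist p q) d0 => d d0; field.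
Qed.

Lemma sqdist_apexr p q la mu a : sqdist p q != 0 ->
  16%:R * a ^+ 2 = heron (sqdist p q) la mu -> sqdist q (apex p q la mu a) = mu.
Proof.
move=> d0 ha; have e := sqdist_apexl d0 ha.
(* The difference of the squared distances from [q] and [p] depends on [dot] only; the area drops
   out. *)
suff : sqdist q (apex p q la mu a) =
  sqdist p (apex p q la mu a) - la + mu by rewrite e subrr add0r.
by rewrite /apex; move: d0; rewrite /sqdist => d0 /=; field.
Qed.

Lemma signed_area_apex p q la mu a : sqdist p q != 0 ->
  signed_area p q (apex p q la mu a) = a.
Proof. by rewrite /apex /signed_area /sqdist => d0 /=; field. Qed.

Lemma heron_eq_pm d la mu a b :
  16%:R * a ^+ 2 = heron d la mu -> 16%:R * b ^+ 2 = heron d la mu ->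
  a = b \/ a = - b.
Proof.
move=> <- /mulfI/eqP; rewrite eqf_sqr => /(_ _)/orP[].
- by rewrite pnatr_eq0.
- by move/eqP; left.
- by move/eqP ->; right; rewrite opprK.
Qed.

Lemma apex_rpred (P : divringClosed C) p q la mu a :
  p.1 \in P -> p.2 \in P -> q.1 \in P -> q.2 \in P ->
  la \in P -> mu \in P -> a \in P ->
  ((apex p q la mu a).1 \in P) && ((apex p q la mu a).2 \in P).
Proof.
move=> p1 p2 q1 q2 hl hm ha; have two : (2%:R : C) \in P by exact: rpred_nat.
rewrite /apex /sqdist /=; apply/andP; split;
  by do ![done | apply: rpredD | apply: rpred_div | apply: rpredM
         | apply: rpredX | rewrite rpredN].
Qed.

Lemma sqdist_rpred (P : divringClosed C) p q :
  p.1 \in P -> p.2 \in P -> q.1 \in P -> q.2 \in P -> sqdist p q \in P.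
Proof.
by move=> p1 p2 q1 q2; rewrite rpredD // rpredX // rpredB.
Qed.

Lemma heron_rpred (P : divringClosed C) d la mu :
  d \in P -> la \in P -> mu \in P -> heron d la mu \in P.
Proof.
move=> dP lP mP; apply: rpredB.
  by apply: rpredM => //; apply: rpredM => //; apply: rpred_nat.
by apply: rpredX; apply: rpredB => //; apply: rpredD.
Qed.

Section Graph.
Variables (Phi : C -> C -> Prop) (hPhi : field_graph Phi).

Definition ptgraph p p' := Phi p.1 p'.1 /\ Phi p.2 p'.2.

Lemma fgraph_sqdist p p' q q' :
  ptgraph p p' -> ptgraph q q' -> Phi (sqdist p q) (sqdist p' q').
Proof.
by move=> [p1 p2] [q1 q2]; apply: fgraphD => //; apply: fgraphX => //;
  apply: fgraphB.
Qed.

Lemma fgraph_heron d d' la la' mu mu' :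
  Phi d d' -> Phi la la' -> Phi mu mu' -> Phi (heron d la mu) (heron d' la' mu').
Proof.
move=> hd hl hm; apply: fgraphB => //.
  by apply: fgraphM => //; apply: fgraphM => //; apply: fgraph_nat.
by apply: fgraphX => //; apply: fgraphB => //; apply: fgraphD.
Qed.

Lemma ptgraph_apex p p' q q' la la' mu mu' a a' :
  ptgraph p p' -> ptgraph q q' -> Phi la la' -> Phi mu mu' -> Phi a a' ->
  ptgraph (apex p q la mu a) (apex p' q' la' mu' a').
Proof.
move=> hp hq hl hm ha; have hd := fgraph_sqdist hp hq.
have two := fgraph_nat hPhi 2.
have hdot := fgraph_div hPhi (fgraphB hPhi (fgraphD hPhi hd hl) hm) two.
case: hp hq => p1 p2 [q1 q2].
have h1 := fgraphB hPhi q1 p1; have h2 := fgraphB hPhi q2 p2.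
have h2a := fgraphM hPhi two ha.
split; rewrite /apex /=; apply: fgraphD => //; apply: fgraph_div => //.
  by apply: fgraphD => //; apply: fgraphM.
by apply: fgraphB => //; apply: fgraphM.
Qed.

End Graph.
End Triangles.

(** * Isotropic lines and products of areas over an algebraically closed field *)

Section ClosedField.
Variable C : numClosedFieldType.

Lemma sqrtC_algclosure (S : C -> Prop) d :
  d \in algclosure S -> sqrtC d \in algclosure S.
Proof. by move=> hd; apply: sqrt_algclosure; rewrite sqrtCK. Qed.

(* A point at squared distance [0] from [p] lies on one of two isotropic lines
   through [p], on which the squared distance from [q] is an affine function. *)
Lemma isotropic_algclosure (S : C -> Prop) (p q r : C * C) :
  p.1 \in algclosure S -> p.2 \in algclosure S ->
  q.1 \in algclosure S -> q.2 \in algclosure S ->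
  sqdist p q != 0 -> sqdist p r = 0 -> sqdist q r \in algclosure S ->
  (r.1 \in algclosure S) /\ (r.2 \in algclosure S).
Proof.
move=> p1 p2 q1 q2 pq0 pr0 qrA.
have [j [jA j2 er]] : exists j, [/\ j \in algclosure S, j ^+ 2 = -1 &
    r.2 - p.2 = j * (r.1 - p.1)].
  have iA : 'i \in algclosure S.
    by apply: sqrt_algclosure; rewrite sqrCi rpredN rpred1.
  have : (r.2 - p.2) ^+ 2 == ('i * (r.1 - p.1)) ^+ 2.
    rewrite exprMn sqrCi mulN1r -addr_eq0 -pr0 /sqdist; apply/eqP; ring.
  rewrite eqf_sqr => /orP[] /eqP e.
    by exists 'i; rewrite iA sqrCi.
  by exists (- 'i); rewrite rpredN iA sqrrN sqrCi mulNr.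
(* The isotropic coordinates of [q - p]: their product is [sqdist p q], and [- 2 u] is the slope of
   the affine function. *)
pose u := q.1 - p.1 + j * (q.2 - p.2); pose u' := q.1 - p.1 - j * (q.2 - p.2).
have uu' : u * u' = sqdist p q.
  have -> : u * u' = (q.1 - p.1) ^+ 2 - j ^+ 2 * (q.2 - p.2) ^+ 2.
    by rewrite /u /u'; ring.
  by rewrite j2 /sqdist; ring.
have u0 : u != 0 by apply: contraNneq pq0 => u0; rewrite -uu' u0 mul0r.
have r2 : r.2 = p.2 + j * (r.1 - p.1) by rewrite -er addrC subrK.
have eqr : sqdist q r = sqdist p q - 2%:R * u * (r.1 - p.1).
  have -> : sqdist q r = sqdist p q - 2%:R * u * (r.1 - p.1) +
      (1 + j ^+ 2) * (r.1 - p.1) ^+ 2.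
    by rewrite /u /sqdist r2; ring.
  by rewrite j2 subrr mul0r addr0.
have r1 : r.1 = p.1 + (sqdist p q - sqdist q r) / (2%:R * u).
  by rewrite eqr; field.
have r1A : r.1 \in algclosure S.
  rewrite r1 rpredD // rpred_div //; first by rewrite rpredB // sqdist_rpred.
  by rewrite rpredM ?rpred_nat // rpredD ?rpredM ?rpredB.
by split=> //; rewrite r2 rpredD // rpredM // rpredB.
Qed.

(** The zeros in [la] of [heron d la (w ^+ 2)]. *)
Definition heron_roots (w d : C) := [:: (sqrtC d + w) ^+ 2; (sqrtC d - w) ^+ 2].

(** If [(s + w) ^ 2 = (s' + w) ^ 2], then [s ^ 2 - s' ^ 2 + 2 (s - s') w = 0]; as [w] is outside the
    closure, the constant term vanishes and both roots belong to the same [d]. The two roots for one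
    [d] differ by [4 s w] with [s ^ 2 = d], which is nonzero. *)
Lemma heron_roots_uniq (S : C -> Prop) w (ds : seq C) :
  w \notin algclosure S -> {subset ds <= algclosure S} -> 0 \notin ds ->
  uniq ds -> uniq (flatten (map (heron_roots w) ds)).
Proof.
move=> wN.
have w_free a b : a \in algclosure S -> b \in algclosure S ->
    a + b * w = 0 -> a = 0.
  move=> aA bA; have [->|b0] := eqVneq b 0; first by rewrite mul0r addr0.
  move=> /eqP; rewrite addr_eq0 => /eqP ea; case/negP: wN.
  by have := rpred_div aA bA; rewrite ea -mulNr mulrAC mulNr divff // mulN1r rpredN.
have rootP d x : x \in heron_roots w d ->
    exists2 s, s ^+ 2 = d & x = (s + w) ^+ 2.
  rewrite !inE => /orP[] /eqP ->; first by exists (sqrtC d); rewrite ?sqrtCK.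
  exists (- sqrtC d); first by rewrite sqrrN sqrtCK.
  by rewrite -sqrrN opprB addrC.
elim: ds => [|d ds IH] //= dsA; rewrite inE negb_or eq_sym => /andP[d0 ds0].
move=> /andP[dN ds_uniq].
have dA : d \in algclosure S by apply: dsA; rewrite mem_head.
rewrite IH // ?andbT; last by move=> x xds; apply: dsA; rewrite inE xds orbT.
have other x : x \in heron_roots w d -> x \notin flatten (map (heron_roots w) ds).
  move=> /rootP[s s2 ->]; apply/negP => /flatten_mapP[d' d'ds /rootP[s' s'2]] e.
  have d'A : d' \in algclosure S by apply: dsA; rewrite inE d'ds orbT.
  have sA : s \in algclosure S by apply: sqrt_algclosure; rewrite s2.
  have s'A : s' \in algclosure S by apply: sqrt_algclosure; rewrite s'2.
  have : d - d' = 0.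
    apply: (w_free _ (2%:R * (s - s'))); rewrite ?rpredB //.
      by rewrite rpredM ?rpred_nat ?rpredB.
    rewrite -s2 -s'2; transitivity ((s + w) ^+ 2 - (s' + w) ^+ 2); first by ring.
    by rewrite e subrr.
  by move/eqP; rewrite subr_eq0 => /eqP edd; move: dN; rewrite edd d'ds.
rewrite !inE negb_or !other ?inE ?eqxx ?orbT // !andbT.
apply/negP => /eqP e; case/negP: wN.
have : sqrtC d * w *+ 4 = 0.
  by rewrite -[RHS](subrr ((sqrtC d + w) ^+ 2)) {2}e; ring.
move/eqP; rewrite mulrn_eq0 /= mulf_eq0 sqrtC_eq0 (negPf d0) /= => /eqP ->.
exact: rpred0.
Qed.

(** The closure of [S] omits [la]: over it the squared product is a constant times a split
    polynomial evaluated at [la]. The closure of [S'] omits [mu]: it makes the roots distinct. *)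
Lemma prod_area_notin (S S' : C -> Prop) (T : eqType) (s : seq T)
    (fa fd : T -> C) la mu :
  la \notin algclosure S -> mu \in algclosure S -> mu \notin algclosure S' ->
  (forall t, t \in s -> [/\ fd t \in algclosure S, fd t \in algclosure S',
     fd t != 0 & 16%:R * fa t ^+ 2 = heron (fd t) la mu]) ->
  uniq (map fd s) -> s != [::] ->
  \prod_(t <- s) fa t \notin ratfun (algclosure S) la.
Proof.
move=> laN muS muN hs s_uniq s0.
pose w := sqrtC mu.
pose rs := flatten (map (heron_roots w) (map fd s)).
have wS : w \in algclosure S by apply: sqrtC_algclosure.
have wN : w \notin algclosure S'.
  by apply: contra muN => h; rewrite -[mu]sqrtCK rpredX.
(* Each squared area contributes a factor [- 1 / 16] from Heron's formula. *)
apply: (@ratfun_nonsquare _ _ _ ((- (16%:R)^-1) ^+ size s) rs).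
- by move=> p pA rp; apply/eqP; apply: contraNT laN => p0; apply: root_algclosure rp.
- by rewrite rpredX // rpredN rpredV rpred_nat.
- by rewrite expf_neq0 // oppr_eq0 invr_eq0 pnatr_eq0.
- move=> x /flatten_mapP[_ /mapP[t ts ->]]; have [fS _ _ _] := hs t ts.
  have sS := sqrtC_algclosure fS.
  by rewrite !inE => /orP[] /eqP->; apply: rpredX; [apply: rpredD | apply: rpredB].
- apply: heron_roots_uniq wN _ _ s_uniq.
    by move=> _ /mapP[t ts ->]; have [] := hs t ts.
  by apply/negP => /mapP[t ts /esym/eqP]; have [_ _ /negPf->] := hs t ts.
- by rewrite /rs; case: (s) s0.
- rewrite /rs; elim: (s) hs => [|t s' IH] hs'.
    by rewrite !big_nil expr1n mulr1.
  have [_ _ _ ht] := hs' t (mem_head _ _).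
  rewrite /= !big_cons exprMn IH; last by move=> u us; apply: hs'; rewrite inE us orbT.
  move: ht; rewrite -{1}[mu]sqrtCK -{1}[fd t]sqrtCK heron_factor -/w => ht.
  have -> : fa t ^+ 2 = - (16%:R)^-1 *
     ((la - (sqrtC (fd t) + w) ^+ 2) * (la - (sqrtC (fd t) - w) ^+ 2)).
    by apply: (mulfI (x := 16%:R)); rewrite ?pnatr_eq0 // ht; field.
  by rewrite [(- _) ^+ _.+1]exprS mulrACA -!mulrA.
Qed.

End ClosedField.

(** * One Henneberg step *)

Lemma set2_inj (T : finType) (u v i k : T) :
  [set u; v] = [set i; k] -> (u = i /\ v = k) \/ (u = k /\ v = i).
Proof.
move=> e.
have := set21 u v; rewrite e => /set2P[] eu; subst u.
  have := set22 i v; rewrite e => /set2P[] ev; subst v; last by left.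
  have := set22 i k; rewrite -e => /set2P[] ek; by left; subst.
have := set22 k v; rewrite e => /set2P[] ev; subst v; first by right.
have := set21 i k; rewrite -e => /set2P[] ek; by left; subst.
Qed.

(** Picks one index for each attained value; excluded middle decides which members of [ds] are
    attained. *)
Lemma finite_reps (I D : eqType) (f : I -> D) (ds : seq D) :
  (forall x, f x \in ds) ->
  exists2 s : seq I, uniq (map f s) & forall x, f x \in map f s.
Proof.
move=> fds.
suff [s us hs] : exists2 s : seq I, uniq (map f s) &
    forall x, f x \in ds -> f x \in map f s.
  by exists s => // x; apply: hs.
elim: ds {fds} => [|d ds [s us hs]]; first by exists [::].
have [ds'|dN] := boolP (d \in map f s).
  by exists s => // x; rewrite inE => /orP[/eqP->|/hs].
have [[x xd]|no] := pselect (exists x, f x = d).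
  exists (x :: s) => /=; first by rewrite xd dN.
  by move=> y; rewrite !inE xd => /orP[->|/hs ->] //; rewrite orbT.
exists s => // x; rewrite inE => /orP[/eqP e|/hs //].
by case: no; exists x.
Qed.

Lemma henneberg1_sub (V : finType) (v1 v2 : V) m W E :
  henneberg1 v1 v2 m W E ->
  [/\ v1 \in W, v2 \in W, forall e, e \in E -> e \subset W &
      forall i j k, (i, j, k) \in m -> [/\ i \in W, j \in W & k \in W]].
Proof.
elim=> [n12|{}m {}W {}E i j k _ [w1 w2 sE sm] iW jW ij kW].
  split; rewrite ?set21 ?set22 // => e; rewrite inE => /eqP->; exact: subxx.
split; rewrite ?in_setU ?w1 ?w2 ?orbT //.
- move=> e; rewrite !inE => /or3P[/eqP->|/eqP->|/sE sEW].
  + by apply/subsetP => u /set2P[]->; rewrite !inE ?iW ?eqxx ?orbT.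
  + by apply/subsetP => u /set2P[]->; rewrite !inE ?jW ?eqxx ?orbT.
  + exact: subset_trans sEW (subsetUr _ _).
- move=> i' j' k'; rewrite mem_rcons inE => /orP[/eqP[-> -> ->]|/sm[]].
    by rewrite !inE iW jW eqxx !orbT.
  by rewrite !inE => -> -> ->; rewrite !orbT.
Qed.

Section Henneberg.
Variables (C : numClosedFieldType) (V : finType) (G : graph V) (v1 v2 : V).
Variable lam : {set V} -> C.
Hypothesis lam_generic : generic_labelling G v1 v2 lam.

Local Notation OE := (other_edges G v1 v2).
Local Notation K := (baseK G v1 v2 lam).

(** By genericity the label of an edge [e] in [OE] is transcendental over this field, which contains
    all other labels. *)
Definition closure_but (e : {set V}) : {pred C} :=
  algclosure (fun x => exists2 f, f \in OE :\ e & x = lam f).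

Local Notation A := closure_but.

HB.instance Definition _ e := GRing.DivringClosed.copy (closure_but e)
  (algclosure (fun x => exists2 f, f \in OE :\ e & x = lam f)).

Lemma lam_notin e : e \in OE -> lam e \notin A e.
Proof. by case: lam_generic => _ hA; apply: alg_independent_notin. Qed.

Lemma lam_in e f : f \in OE -> f != e -> lam f \in A e.
Proof. by move=> fO fe; apply: mem_algclosure; exists f; rewrite // in_setD1 fe. Qed.

(** Functions on all of [V], arbitrary at vertices not yet built, so that the same functions serve
    at every stage. *)
Definition partial_real (E : {set {set V}}) (rho : V -> C * C) : Prop :=
  [/\ rho v1 = (0, 0), rho v2 = (1, 0) &
      forall u v, [set u; v] \in E -> lam [set u; v] = sqdist (rho u) (rho v)].

Lemma partial_realS (E E' : {set {set V}}) rho :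
  E \subset E' -> partial_real E' rho -> partial_real E rho.
Proof. by move=> /subsetP sE [r1 r2 rE]; split=> // u v /sE; apply: rE. Qed.

(* That a coordinate is algebraic over the labels on [E] is expressed as its
   membership in [closure_but e] for every further edge [e]. *)
Definition tame (W : {set V}) (E : {set {set V}}) := forall rho, partial_real E rho ->
  (forall v e, v \in W -> e \in OE -> e \notin E ->
     (rho v).1 \in A e /\ (rho v).2 \in A e) /\
  (forall u v, u \in W -> v \in W -> u != v -> sqdist (rho u) (rho v) != 0).

Section Step.
Variables (m : seq (V * V * V)) (W : {set V}) (E : {set {set V}}) (i j k : V).
Hypothesis hW : henneberg1 v1 v2 m W E.
Hypotheses (iW : i \in W) (jW : j \in W) (ij : i != j) (kW : k \notin W).
Let E' := [set i; k] |: ([set j; k] |: E).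
Hypothesis sE' : E' \subset edges G.
Hypothesis tameW : tame W E.

Local Notation la := (lam [set i; k]).
Local Notation mu := (lam [set j; k]).
Local Notation ar rho := (signed_area (rho i) (rho j) (rho k)).

Let ki : k != i. Proof. by apply: contraNneq kW => ->. Qed.
Let kj : k != j. Proof. by apply: contraNneq kW => ->. Qed.

Lemma step_edge_notin u : [set u; k] \notin E.
Proof.
have [_ _ sE _] := henneberg1_sub hW.
by apply/negP => /sE /subsetP /(_ k); rewrite set22 (negPf kW) => /(_ isT).
Qed.

Lemma step_edge_neq : [set i; k] != [set j; k].
Proof.
apply/eqP => /set2_inj[][e1 e2]; first by move: ij; rewrite e1 eqxx.
by move: kj; rewrite e2 eqxx.
Qed.

Let step_edge_other u : [set u; k] \in E' -> [set u; k] \in OE.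
Proof.
move=> ue; rewrite in_setD1 (subsetP sE') // andbT.
have [w1 w2 _ _] := henneberg1_sub hW.
apply/eqP => e; have := set22 u k; rewrite e => /set2P[] ek;
by move: kW; rewrite ek ?w1 ?w2.
Qed.

Lemma step_edge1 : [set i; k] \in OE.
Proof. by apply: step_edge_other; rewrite !inE eqxx. Qed.

Lemma step_edge2 : [set j; k] \in OE.
Proof. by apply: step_edge_other; rewrite !inE eqxx orbT. Qed.

Let sEE' : E \subset E'.
Proof. by apply/subsetP => e eE; rewrite !inE eE !orbT. Qed.

Lemma step_labels rho : partial_real E' rho ->
  la = sqdist (rho i) (rho k) /\ mu = sqdist (rho j) (rho k).
Proof. by case=> _ _ h; split; apply: h; rewrite !inE eqxx ?orbT. Qed.

Lemma step_heron rho : partial_real E' rho ->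
  16%:R * ar rho ^+ 2 = heron (sqdist (rho i) (rho j)) la mu.
Proof. by move=> /step_labels[-> ->]; apply: heron_area. Qed.

Lemma step_nondeg rho : partial_real E rho -> sqdist (rho i) (rho j) != 0.
Proof. by move=> /tameW[_]; apply. Qed.

Lemma step_apex rho : partial_real E' rho ->
  rho k = apex (rho i) (rho j) la mu (ar rho).
Proof.
move=> hr; have [-> ->] := step_labels hr; rewrite apexE //.
exact: step_nondeg (partial_realS sEE' hr).
Qed.

Lemma step_dist_in rho e : partial_real E rho -> e \in OE -> e \notin E ->
  sqdist (rho i) (rho j) \in A e.
Proof.
move=> hr eO eE; have [h _] := tameW hr.
by have [? ?] := h i e iW eO eE; have [? ?] := h j e jW eO eE; apply: sqdist_rpred.
Qed.

Lemma step_area_in rho e : partial_real E' rho -> e \in OE -> e \notin E' ->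
  ar rho \in A e.
Proof.
move=> hr eO; rewrite !inE !negb_or => /and3P[e1 e2 eE].
have dA := step_dist_in (partial_realS sEE' hr) eO eE.
have lA : la \in A e by rewrite lam_in ?step_edge1 // eq_sym.
have mA : mu \in A e by rewrite lam_in ?step_edge2 // eq_sym.
apply: sqrt_algclosure; rewrite -/(A e).
have -> : ar rho ^+ 2 = heron (sqdist (rho i) (rho j)) la mu / 16%:R.
  by rewrite -step_heron // mulrC mulKf // pnatr_eq0.
by rewrite rpred_div ?rpred_nat // heron_rpred.
Qed.

Lemma step_tame : tame (k |: W) E'.
Proof.
move=> rho hr; have hr0 := partial_realS sEE' hr; have [hA hD] := tameW hr0.
have [el em] := step_labels hr.
split.
  move=> v e; rewrite in_setU1 => /orP[/eqP->|vW] eO eE'; last first.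
    by apply: hA => //; apply: contra eE'; apply: (subsetP sEE').
  have arA := step_area_in hr eO eE'.
  move: eE'; rewrite !inE !negb_or => /and3P[e1 e2 eE].
  have [? ?] := hA i e iW eO eE; have [? ?] := hA j e jW eO eE.
  rewrite (step_apex hr); apply/andP; apply: apex_rpred => //.
    by rewrite lam_in ?step_edge1 // eq_sym.
  by rewrite lam_in ?step_edge2 // eq_sym.
(* For [p] equal to [i] or [j] a label would be zero. Otherwise [k] would lie on an isotropic line
   through [p], so [mu] alone would determine it up to finitely many choices, and [la] would be
   algebraic over the other labels. *)
have main p : p \in W -> sqdist (rho p) (rho k) != 0.
  move=> pW; apply/eqP => pk0.
  have [pi|pi] := eqVneq p i.
    by have := lam_notin step_edge1; rewrite el -pi pk0 rpred0.
  have [pj|pj] := eqVneq p j.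
    by have := lam_notin step_edge2; rewrite em -pj pk0 rpred0.
  have eN := step_edge_notin i.
  have [p1 p2] := hA p _ pW step_edge1 eN.
  have [i1 i2] := hA i _ iW step_edge1 eN.
  have [j1 j2] := hA j _ jW step_edge1 eN.
  have [|k1 k2] := isotropic_algclosure p1 p2 j1 j2 (hD _ _ pW jW pj) pk0.
    by rewrite -em; apply: lam_in; rewrite ?step_edge2 // eq_sym step_edge_neq.
  by have := lam_notin step_edge1; rewrite el sqdist_rpred.
move=> u v; rewrite !in_setU1 => /orP[/eqP->|uW] /orP[/eqP->|vW] uv.
- by rewrite eqxx in uv.
- by rewrite sqdistC main.
- exact: main.
- exact: hD.
Qed.

(** A degenerate triangle would force [la] to be [(s + t) ^ 2] or [(s - t) ^ 2] with [s] and [t]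
    algebraic over the other labels. *)
Lemma step_area_neq0 rho : partial_real E' rho -> ar rho != 0.
Proof.
move=> hr; apply/eqP => a0; have := step_heron hr; rewrite a0 expr0n mulr0.
have dA := step_dist_in (partial_realS sEE' hr) step_edge1 (step_edge_notin i).
rewrite -[mu]sqrtCK -[sqdist _ _]sqrtCK heron_factor => /esym/eqP.
have sA := sqrtC_algclosure dA.
have tA : sqrtC mu \in A [set i; k].
  by apply: sqrtC_algclosure; apply: lam_in; rewrite ?step_edge2 // eq_sym step_edge_neq.
have := lam_notin step_edge1 => /negP laN.
rewrite oppr_eq0 mulf_eq0 !subr_eq0 => /orP[] /eqP e; apply: laN; rewrite e rpredX //.
  exact: rpredD.
exact: rpredB.
Qed.

Lemma step_extend rho a : partial_real E rho ->
  16%:R * a ^+ 2 = heron (sqdist (rho i) (rho j)) la mu ->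
  exists rho', [/\ partial_real E' rho', forall v, v \in W -> rho' v = rho v &
    ar rho' = a].
Proof.
move=> hr ha; have d0 := step_nondeg hr.
pose rho' v := if v == k then apex (rho i) (rho j) la mu a else rho v.
have rW v : v \in W -> rho' v = rho v.
  by rewrite /rho'; case: eqP => // -> vW; move: kW; rewrite vW.
have rk : rho' k = apex (rho i) (rho j) la mu a by rewrite /rho' eqxx.
exists rho'; split=> //; last by rewrite rk !rW // signed_area_apex.
have [w1 w2 sE _] := henneberg1_sub hW; have [r1 r2 rE] := hr.
split; rewrite ?rW //.
move=> u v; rewrite !inE => /or3P[/eqP e|/eqP e|uvE].
- rewrite e; case: (set2_inj e) => [][-> ->]; last rewrite [RHS]sqdistC;
    by rewrite rk rW // sqdist_apexl.
- rewrite e; case: (set2_inj e) => [][-> ->]; last rewrite [RHS]sqdistC;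
    by rewrite rk rW // sqdist_apexr.
- have /subsetP sW := sE _ uvE.
  by rewrite rE // !rW // sW ?set21 ?set22.
Qed.

Lemma step_determined rho rho' : partial_real E' rho -> partial_real E' rho' ->
  (forall v, v \in W -> rho v = rho' v) -> ar rho = ar rho' ->
  forall v, v \in k |: W -> rho v = rho' v.
Proof.
move=> hr hr' rW ra v; rewrite in_setU1 => /orP[/eqP->|/rW //].
by rewrite (step_apex hr) (step_apex hr') ra !rW.
Qed.

End Step.
End Henneberg.

(** * Induction over the Henneberg steps *)

Section Induction.
Variables (C : numClosedFieldType) (V : finType) (G : graph V) (v1 v2 : V).
Variable lam : {set V} -> C.
Hypothesis lam_generic : generic_labelling G v1 v2 lam.

Local Notation OE := (other_edges G v1 v2).
Local Notation K := (baseK G v1 v2 lam).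
Local Notation A := (closure_but G v1 v2 lam).
Local Notation preal := (partial_real v1 v2 lam).
Local Notation ar i j k rho := (signed_area (rho i) (rho j) (rho k)).

Lemma henneberg_tame m W E : henneberg1 v1 v2 m W E -> E \subset edges G ->
  tame G v1 v2 lam W E.
Proof.
elim=> [n12 _|{}m {}W {}E i j k hW IH iW jW ij kW sE'].
  move=> rho [r1 r2 _]; split=> [v e /set2P[]-> _ _|u v].
  - by rewrite r1 /= rpred0.
  - by rewrite r2 /= rpred1 rpred0.
  - by move=> /set2P[]-> /set2P[]->; rewrite ?eqxx // r1 r2 /sqdist /= => _;
      rewrite !(subr0, sub0r, sqrrN, expr1n, expr0n, addr0) oner_eq0.
have sE : E \subset edges G.
  by apply: subset_trans sE'; apply/subsetP => e eE; rewrite !inE eE !orbT.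
exact: (step_tame lam_generic hW iW jW ij kW sE' (IH sE)).
Qed.

Lemma henneberg_determined m W E rho rho' :
  henneberg1 v1 v2 m W E -> E \subset edges G -> preal E rho -> preal E rho' ->
  (forall i j k, (i, j, k) \in m -> ar i j k rho = ar i j k rho') ->
  forall v, v \in W -> rho v = rho' v.
Proof.
elim=> [n12 _ [r1 r2 _] [r1' r2' _] _ v /set2P[]->|]; rewrite ?r1 ?r2 //.
move=> {}m {}W {}E i j k hW IH iW jW ij kW sE' hr hr' har.
have sEE' : E \subset [set i; k] |: ([set j; k] |: E).
  by apply/subsetP => e eE; rewrite !inE eE !orbT.
have sE := subset_trans sEE' sE'.
apply: (step_determined iW jW ij (henneberg_tame hW sE) hr hr').
- apply: IH => //; try exact: partial_realS sEE' _.
  by move=> i' j' k' hm; apply: har; rewrite mem_rcons inE hm orbT.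
- by apply: har; rewrite mem_rcons mem_head.
Qed.

(** Over each of the finitely many bases a new vertex has at most two positions, with opposite
    areas. Hence only finitely many square roots are adjoined per step. *)
Lemma henneberg_finite m W E : henneberg1 v1 v2 m W E -> E \subset edges G ->
  exists s : seq (C * C), forall rho v, preal E rho -> v \in W -> rho v \in s.
Proof.
elim=> [n12 _|{}m {}W {}E i j k hW IH iW jW ij kW sE'].
  exists [:: (0, 0); (1, 0)] => rho v [r1 r2 _] /set2P[]->.
    by rewrite r1 mem_head.
  by rewrite r2 inE mem_head orbT.
have sEE' : E \subset [set i; k] |: ([set j; k] |: E).
  by apply/subsetP => e eE; rewrite !inE eE !orbT.
have sE := subset_trans sEE' sE'; have [s hs] := IH sE.
pose la := lam [set i; k]; pose mu := lam [set j; k].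
pose a (z : C * C * (C * C)) := sqrtC (heron (sqdist z.1 z.2) la mu / 16%:R).
pose s2 := [seq (x, y) | x <- s, y <- s].
exists (s ++ [seq apex z.1 z.2 la mu (a z) | z <- s2] ++
        [seq apex z.1 z.2 la mu (- a z) | z <- s2]) => rho v hr.
have hr0 := partial_realS sEE' hr.
rewrite in_setU1 !mem_cat => /orP[/eqP->|vW]; last by rewrite hs.
have zs2 : (rho i, rho j) \in s2.
  by apply/allpairsP; exists (rho i, rho j); rewrite !hs.
rewrite (step_apex iW jW ij (henneberg_tame hW sE) hr).
have ha : 16%:R * a (rho i, rho j) ^+ 2 = heron (sqdist (rho i) (rho j)) la mu.
  by rewrite /a sqrtCK /= mulrC divfK // pnatr_eq0.
have [->|->] := heron_eq_pm (step_heron hr) ha; apply/orP; right; apply/orP.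
  by left; apply/mapP; exists (rho i, rho j).
by right; apply/mapP; exists (rho i, rho j).
Qed.

Lemma baseK_ratfun e x : x \in K -> x \in ratfun (A e) (lam e).
Proof.
move/genfieldP; apply; first exact: ratfun_divring_closed.
move=> _ [f fO ->]; have [->|fe] := eqVneq f e; first exact: ratfun_gen.
by apply: ratfun_base; apply: lam_in.
Qed.

(** * Families of realizations matched by an area-respecting permutation *)

Section Family.
Variables (I : eqType) (p q : I -> V -> C * C).

(* The assignment of [q x] to [p x] is the given permutation; totality and
   injectivity hold up to agreement on [W], so that one index type [I] serves
   for all stages of the construction. *)
Record area_family (m : seq (V * V * V)) (W : {set V}) (E : {set {set V}}) : Prop :=
  AreaFamily {
    family_src : forall x, preal E (p x);
    family_dst : forall x, preal E (q x);
    family_total : forall rho, preal E rho ->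
      exists x, forall v, v \in W -> p x v = rho v;
    family_inj : forall x y, (forall v, v \in W -> q x v = q y v) ->
      forall v, v \in W -> p x v = p y v;
    family_area : forall x y i j k, (i, j, k) \in m ->
      ar i j k (p x) = ar i j k (p y) -> ar i j k (q x) = ar i j k (q y) }.

Section Step.
Variables (m : seq (V * V * V)) (W : {set V}) (E : {set {set V}}) (i j k : V).
Hypothesis hW : henneberg1 v1 v2 m W E.
Hypotheses (iW : i \in W) (jW : j \in W) (ij : i != j) (kW : k \notin W).
Let E' := [set i; k] |: ([set j; k] |: E).
Hypothesis sE' : E' \subset edges G.
Hypothesis fam : area_family (rcons m (i, j, k)) (k |: W) E'.

Local Notation la := (lam [set i; k]).
Local Notation mu := (lam [set j; k]).

Let sEE' : E \subset E'.
Proof. by apply/subsetP => e eE; rewrite !inE eE !orbT. Qed.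
Let sE : E \subset edges G. Proof. exact: subset_trans sEE' sE'. Qed.
Let tameW : tame G v1 v2 lam W E. Proof. exact: henneberg_tame hW sE. Qed.
Let areaS x y i' j' k' : (i', j', k') \in m ->
  ar i' j' k' (p x) = ar i' j' k' (p y) -> ar i' j' k' (q x) = ar i' j' k' (q y).
Proof. by move=> hm; apply: (family_area fam); rewrite mem_rcons inE hm orbT. Qed.
Let areak x y :
  ar i j k (p x) = ar i j k (p y) -> ar i j k (q x) = ar i j k (q y).
Proof. by apply: (family_area fam); rewrite mem_rcons mem_head. Qed.

(** Flipping [k] in [p x] keeps all earlier areas, so [q y] agrees with [q x] on [W]. If the new
    areas agreed as well, injectivity would make [p x] and [p y] agree at [k], against
    [step_area_neq0]. *)
Lemma family_flip x : exists y,
  [/\ forall v, v \in W -> p y v = p x v, ar i j k (p y) = - ar i j k (p x),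
      forall v, v \in W -> q y v = q x v & ar i j k (q y) = - ar i j k (q x)].
Proof.
have px := family_src fam x; have qx := family_dst fam x.
have ha : 16%:R * (- ar i j k (p x)) ^+ 2 =
    heron (sqdist (p x i) (p x j)) la mu by rewrite sqrrN; apply: step_heron px.
have [rho [hrho rhoW rhoa]] :=
  step_extend hW iW jW ij kW tameW (partial_realS sEE' px) ha.
have [y hy] := family_total fam hrho.
have py := family_src fam y; have qy := family_dst fam y.
have pyW v : v \in W -> p y v = p x v.
  by move=> vW; rewrite hy ?rhoW // in_setU1 vW orbT.
have pya : ar i j k (p y) = - ar i j k (p x).
  by rewrite -rhoa !hy // !inE ?iW ?jW ?eqxx ?orbT.
have qyW v : v \in W -> q y v = q x v.
  apply: (henneberg_determined hW sE); try exact: partial_realS sEE' _.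
  move=> i' j' k' hm; apply: areaS => //.
  have [_ _ _ sm] := henneberg1_sub hW.
  by have [? ? ?] := sm _ _ _ hm; rewrite !pyW.
exists y; split=> //.
have hqx : 16%:R * ar i j k (q x) ^+ 2 = heron (sqdist (q y i) (q y j)) la mu.
  by rewrite qyW // (qyW j) //; apply: step_heron qx.
have [eq|//] := heron_eq_pm (step_heron qy) hqx.
have hxy := step_determined iW jW ij tameW qy qx qyW eq.
have := family_inj fam hxy => pxy.
have : ar i j k (p x) != 0 by apply: (step_area_neq0 lam_generic hW).
have : ar i j k (p x) = - ar i j k (p x).
  by rewrite -{1}pya !pxy // !inE ?iW ?jW ?eqxx ?orbT.
by move/eqP; rewrite -addr_eq0 -mulr2n mulrn_eq0 /= => ->.
Qed.

(** Totality holds because realizations extend to [k]. For injectivity, if [q x] and [q y] agree on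
    [W], their new areas agree up to sign; for opposite signs [x] is replaced by its flip, which
    does not change [p x] on [W]. *)
Lemma family_step : area_family m W E.
Proof.
split.
- by move=> x; apply: partial_realS sEE' _; apply: family_src fam x.
- by move=> x; apply: partial_realS sEE' _; apply: family_dst fam x.
- move=> rho hr.
  pose a := sqrtC (heron (sqdist (rho i) (rho j)) la mu / 16%:R).
  have ha : 16%:R * a ^+ 2 = heron (sqdist (rho i) (rho j)) la mu.
    by rewrite /a sqrtCK /= mulrC divfK // pnatr_eq0.
  have [rho' [hrho rhoW _]] := step_extend hW iW jW ij kW tameW hr ha.
  have [x hx] := family_total fam hrho; exists x => v vW.
  by rewrite hx ?rhoW // in_setU1 vW orbT.
- move=> x y qxy v vW.
  have qx := family_dst fam x; have qy := family_dst fam y.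
  have vW' : v \in k |: W by rewrite in_setU1 vW orbT.
  have hqy : 16%:R * ar i j k (q y) ^+ 2 = heron (sqdist (q x i) (q x j)) la mu.
    by rewrite qxy // (qxy j) //; apply: step_heron qy.
  have [eq|eq] := heron_eq_pm (step_heron qx) hqy.
  + apply: (family_inj fam) vW'.
    exact: (step_determined iW jW ij tameW qx qy qxy eq).
  + have [z [pzW pza qzW qza]] := family_flip x.
    rewrite -pzW //; apply: (family_inj fam) vW'.
    apply: (step_determined iW jW ij tameW (family_dst fam z) qy).
      by move=> u uW; rewrite qzW // qxy.
    by rewrite qza eq opprK.
- exact: areaS.
Qed.

Variable Phi : C -> C -> Prop.
Hypotheses (hPhi : field_graph Phi) (PhiK : forall x, x \in K -> Phi x x).
Hypothesis Phi_pt : forall x v, v \in W -> ptgraph Phi (p x v) (q x v).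
Hypothesis Phi_dom : forall e, e \in OE -> e \notin E ->
  {subset fdom Phi <= ratfun (A e) (lam e)}.

(** Kummer theory adjoins one area for each squared distance. The last clause, on edges still to
    come, is what lets the next step apply [prod_area_notin]. *)
Lemma family_extend : exists Psi : C -> C -> Prop,
  [/\ field_graph Psi, forall x, x \in K -> Psi x x,
      forall x v, v \in k |: W -> ptgraph Psi (p x v) (q x v) &
      forall e, e \in OE -> e \notin E' ->
        {subset fdom Psi <= ratfun (A e) (lam e)}].
Proof.
have e1 := step_edge1 hW kW sE'; have e2 := step_edge2 hW kW sE'.
have [s hs] := henneberg_finite hW sE.
pose fd x := sqdist (p x i) (p x j).
have p0 x : preal E (p x) by apply: partial_realS sEE' _; apply: family_src fam x.
have [x|reps reps_uniq repsP] := @finite_reps I C fd [seq sqdist y z | y <- s, z <- s].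
  by apply/allpairsP; exists (p x i, p x j); rewrite !hs.
have laK : la \in K by apply: mem_genfield; exists [set i; k].
have muK : mu \in K by apply: mem_genfield; exists [set j; k].
have ar2 rho : preal E' rho ->
    ar i j k rho ^+ 2 = heron (sqdist (rho i) (rho j)) la mu / 16%:R.
  by move=> /step_heron <-; rewrite mulrC mulKf // pnatr_eq0.
(* Areas over the same squared distance agree up to sign, so only one of them can be prescribed. *)
pose prs := [seq (ar i j k (p x), ar i j k (q x)) | x <- reps].
have [] := @field_graph_kummer C prs Phi _ hPhi.
- by rewrite pnatr_eq0.
- move=> _ /mapP[x xr ->] /=.
  rewrite (ar2 _ (family_src fam x)) (ar2 _ (family_dst fam x)).
  apply: fgraph_div => //; last exact: fgraph_nat.
  apply: fgraph_heron => //; try exact: PhiK.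
  by apply: fgraph_sqdist => //; apply: Phi_pt.
- move=> t; rewrite /unzip1 -map_comp => /subseqP[b _ ->].
  rewrite -map_mask big_map => t0.
  apply/negP => /(Phi_dom e1 (step_edge_notin hW kW i)); apply/negP.
  apply: (@prod_area_notin C _ (fun x => exists2 f, f \in OE :\ [set j; k] & x = lam f)
            I (mask b reps) _ fd la mu).
  + exact: lam_notin.
  + by apply: lam_in => //; rewrite eq_sym; apply: (step_edge_neq jW ij kW).
  + exact: (lam_notin lam_generic e2).
  + move=> x _; split.
    * exact: (step_dist_in iW jW tameW (p0 x) e1 (step_edge_notin hW kW i)).
    * exact: (step_dist_in iW jW tameW (p0 x) e2 (step_edge_notin hW kW j)).
    * exact: (step_nondeg iW jW ij tameW).
    * exact: step_heron (family_src fam x).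
  + by rewrite map_mask mask_uniq.
  + by apply: contraNneq t0 => ->.
move=> Psi [hPsi PhiPsi Psi_prs Psi_dom]; exists Psi; split=> //.
- by move=> x /PhiK /PhiPsi.
- have Psi_pt x v : v \in W -> ptgraph Psi (p x v) (q x v).
    by move=> vW; have [? ?] := Phi_pt x vW; split; apply: PhiPsi.
  (* Any other area equals that of a representative up to sign: [areak] settles equal areas,
     [family_flip] opposite ones. *)
  have Psi_ar x : Psi (ar i j k (p x)) (ar i j k (q x)).
    have /mapP[y yr exy] := repsP x.
    have Psi_y : Psi (ar i j k (p y)) (ar i j k (q y)).
      by apply: (Psi_prs (_, _)); apply/mapP; exists y.
    have hx := step_heron (family_src fam x); rewrite -/(fd x) exy in hx.
    have [e|e] := heron_eq_pm hx (step_heron (family_src fam y)).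
      by rewrite (areak e) e.
    have [z [_ pza _ qza]] := family_flip y.
    rewrite (areak (etrans e (esym pza))) qza e; exact: fgraphN.
  move=> x v; rewrite in_setU1 => /orP[/eqP->|]; last exact: Psi_pt.
  rewrite (step_apex iW jW ij tameW (family_src fam x)).
  rewrite (step_apex iW jW ij tameW (family_dst fam x)).
  by apply: ptgraph_apex => //; [apply: Psi_pt | apply: Psi_pt
    | apply/PhiPsi/PhiK | apply/PhiPsi/PhiK].
- move=> e eO eE'; apply: Psi_dom.
    by apply: Phi_dom => //; apply: contra eE'; apply: (subsetP sEE').
  move=> _ /mapP[_ /mapP[x _ ->] ->] /=; apply: ratfun_base.
  exact: (step_area_in hW iW jW kW sE' tameW (family_src fam x)).
Qed.

End Step.

Lemma family_field_graph m W E : henneberg1 v1 v2 m W E -> E \subset edges G ->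
  area_family m W E -> exists Phi : C -> C -> Prop,
  [/\ field_graph Phi, forall x, x \in K -> Phi x x,
      forall x v, v \in W -> ptgraph Phi (p x v) (q x v) &
      forall e, e \in OE -> e \notin E ->
        {subset fdom Phi <= ratfun (A e) (lam e)}].
Proof.
elim=> [n12 _ fam|{}m {}W {}E i j k hW IH iW jW ij kW sE' fam].
  (* The two normalized vertices have coordinates 0 and 1, so the identity of [K] is the start. *)
  exists (fun x y => x \in K /\ x = y); split=> //.
  - split; first by rewrite rpred1.
    + by move=> x _ x' _ [hx <-] [hx' <-]; rewrite rpredB.
    + by move=> x _ x' _ [hx <-] [hx' <-]; rewrite rpredM.
    + by move=> x _ [hx <-]; rewrite rpredV.
    + by move=> y [_ <-].
  - move=> x v hv; have [p1 p2 _] := family_src fam x.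
    have [q1 q2 _] := family_dst fam x.
    by case/set2P: hv => ->; rewrite ?p1 ?p2 ?q1 ?q2 /ptgraph /= ?rpred0 ?rpred1.
  - by move=> e _ _ x /fdomP[y [hx _]]; apply: baseK_ratfun.
have sE : E \subset edges G.
  by apply: subset_trans sE'; apply/subsetP => e eE; rewrite !inE eE !orbT.
have [Phi [h1 h2 h3 h4]] := IH sE (family_step hW iW jW ij kW sE' fam).
exact: (family_extend hW iW jW ij kW sE' fam h1 h2 h3 h4).
Qed.

End Family.
End Induction.

(** * The Galois action *)

Section GaloisAction.
Variables (C : numFieldType) (V : finType) (G : graph V) (v1 v2 : V).
Variable lam : {set V} -> C.

Local Notation gal := (gal G v1 v2 lam).
Local Notation nreal := (nreal G v1 v2 lam).
Local Notation extE := (extE G v1 v2 lam).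
Local Notation K := (baseK G v1 v2 lam).

Lemma gal_of_fun (f : extE -> extE) :
  {morph f : x y / x - y} -> f 1 = 1 -> {morph f : x y / x * y} -> bijective f ->
  (forall x : extE, genfield_val x \in K -> f x = x) ->
  exists s : gal, s =1 f.
Proof.
move=> fB f1 fM f_bij f_fix.
pose F : {rmorphism extE -> extE} := HB.pack f
  (GRing.isZmodMorphism.Build _ _ f fB)
  (GRing.isMonoidMorphism.Build _ _ f (f1, fM)).
by exists (@Gal _ _ _ _ _ _ F f_bij f_fix).
Qed.

Lemma gal_inv (s : gal) : exists2 t : gal, cancel s t & cancel t s.
Proof.
have [h sh hs] := gal_bij s.
have s_inj := can_inj sh.
have [] := @gal_of_fun h.
- by move=> x y; apply: s_inj; rewrite rmorphB !hs.
- by apply: s_inj; rewrite rmorph1 hs.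
- by move=> x y; apply: s_inj; rewrite rmorphM !hs.
- by exists s.
- by move=> x xK; apply: s_inj; rewrite hs gal_fix.
by move=> t th; exists t => x; rewrite th.
Qed.

Lemma coord1_gal_act (s : gal) (rho : nreal) v :
  coord1 (gal_act s rho) v = s (coord1 rho v).
Proof. by apply: val_inj; rewrite /= ffunE. Qed.

Lemma coord2_gal_act (s : gal) (rho : nreal) v :
  coord2 (gal_act s rho) v = s (coord2 rho v).
Proof. by apply: val_inj; rewrite /= ffunE. Qed.

Lemma gal_act_comp (s t : gal) :
  gal_act (gal_comp s t) =1 gal_act s \o gal_act t.
Proof.
move=> rho; apply/val_inj/ffunP => v.
by rewrite /= /gal_act_fun !ffunE coord1_gal_act coord2_gal_act.
Qed.

Lemma gal_actK (s t : gal) : cancel s t -> cancel (gal_act s) (gal_act t).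
Proof.
move=> st rho; apply/val_inj/ffunP => v.
rewrite /= /gal_act_fun ffunE coord1_gal_act coord2_gal_act !st /=.
by rewrite -surjective_pairing.
Qed.

Lemma gal_act_bij (s : gal) : bijective (gal_act s).
Proof. by have [t st ts] := gal_inv s; exists (gal_act t); apply: gal_actK. Qed.

Lemma extE_ind (P : {pred C}) : GRing.divring_closed P ->
  (forall x, x \in K -> x \in P) ->
  (forall (rho : nreal) v, (rho v).1 \in P /\ (rho v).2 \in P) ->
  forall x : extE, genfield_val x \in P.
Proof.
move=> cP PK Pc x; have /genfieldP := genfield_valP x; apply=> // y.
by case=> [/PK//|[rho [v]]]; have [? ?] := Pc rho v; case=> ->.
Qed.

(** The elements with a partner in [extE] form a field containing the generators. Used for a partial
    isomorphism and for its converse, this gives a bijection of [extE]. *)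
Lemma extE_field_graph Phi : field_graph Phi -> (forall x, x \in K -> Phi x x) ->
  (forall (rho : nreal) v, exists rho' : nreal, ptgraph Phi (rho v) (rho' v)) ->
  forall x : extE, exists y : extE, Phi (genfield_val x) (genfield_val y).
Proof.
move=> hPhi PhiK Phi_pt x.
pose P : {pred C} := fun z => `[< exists y : extE, Phi z (genfield_val y) >].
suff /asboolP : genfield_val x \in P by [].
apply: extE_ind x.
- split=> [|x y /asboolP[x' hx] /asboolP[y' hy]|x y /asboolP[x' hx] /asboolP[y' hy]];
    apply/asboolP.
  + by exists 1; apply: fgraph1.
  + by exists (x' - y'); apply: fgraphB.
  + by exists (x' / y'); apply: fgraph_div.
- move=> z zK; apply/asboolP; exists (GenField (mem_genfield (or_introl zK))).
  exact: PhiK.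
- move=> rho v; have [rho' [h1 h2]] := Phi_pt rho v.
  by split; apply/asboolP; [exists (coord1 rho' v) | exists (coord2 rho' v)].
Qed.

(** Two automorphisms agree on a subfield, here one containing [K] and all coordinates. *)
Lemma gal_act_faithful (s t : gal) : gal_act s =1 gal_act t -> s =1 t.
Proof.
move=> st x.
pose P : {pred C} := fun z => `[< exists2 y : extE, genfield_val y = z & s y = t y >].
have /asboolP[y /val_inj <- //] : genfield_val x \in P.
apply: extE_ind x.
- split=> [|_ _ /asboolP[y <- sy] /asboolP[z <- sz]|_ _ /asboolP[y <- sy] /asboolP[z <- sz]];
    apply/asboolP.
  + by exists 1; rewrite ?rmorph1.
  + by exists (y - z); rewrite ?rmorphB ?sy ?sz.
  + by exists (y / z); rewrite ?fmorph_div ?sy ?sz.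
- move=> z zK; apply/asboolP.
  exists (GenField (mem_genfield (or_introl zK))) => //.
  by rewrite !gal_fix.
- move=> rho v; split; apply/asboolP.
    by exists (coord1 rho v); rewrite // -!coord1_gal_act st.
  by exists (coord2 rho v); rewrite // -!coord2_gal_act st.
Qed.

(** The area is a polynomial with rational coefficients in the coordinates, so it lies in [extE] and
    automorphisms commute with it. *)
Lemma gal_act_area (s : gal) i j k : exists f : nreal -> extE,
  forall rho : nreal, area i j k rho = genfield_val (f rho) /\
              area i j k (gal_act s rho) = genfield_val (s (f rho)).
Proof.
pose f (rho : nreal) : extE := (2%:R)^-1 *
  ((coord1 rho j - coord1 rho k) * (coord2 rho i - coord2 rho k) -
   (coord1 rho i - coord1 rho k) * (coord2 rho j - coord2 rho k)).
exists f => rho; rewrite /area /signed_area.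
have two : genfield_val (2%:R : extE)^-1 = 2^-1 by [].

split; first by rewrite /f /= -two.
rewrite /f rmorphM fmorphV rmorph_nat rmorphB !rmorphM !rmorphB -two /=.
by rewrite /gal_act_fun !ffunE.
Qed.

End GaloisAction.

(** * Automorphisms realizing area-respecting permutations *)

Section Realize.
Variables (C : numClosedFieldType) (V : finType) (G : graph V) (v1 v2 : V).
Variable lam : {set V} -> C.
Hypothesis lam_generic : generic_labelling G v1 v2 lam.
Variable m : seq (V * V * V).
Hypothesis hG : henneberg1 v1 v2 m [set: V] (edges G).

Local Notation gal := (gal G v1 v2 lam).
Local Notation nreal := (nreal G v1 v2 lam).
Local Notation extE := (extE G v1 v2 lam).
Local Notation K := (baseK G v1 v2 lam).

Lemma nreal_partial_real (rho : nreal) : partial_real v1 v2 lam (edges G) rho.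
Proof.
have /andP[/forallP cr /andP[/eqP r1 /eqP r2]] := nreal_valP rho.
by split=> // u v uv; have /forallP/(_ v)/implyP/(_ uv)/eqP := cr u.
Qed.

Lemma gal_of_area_map (g : nreal -> nreal) : bijective g ->
  (forall i j k (rho rho' : nreal), (i, j, k) \in m ->
    area i j k rho = area i j k rho' ->
    area i j k (g rho) = area i j k (g rho')) ->
  exists s : gal, gal_act s =1 g.
Proof.
move=> g_bij g_area; have [h gh hg] := g_bij.
(* Realizations index themselves; at the last stage agreement on [W] is equality. *)
have fam : area_family v1 v2 lam (fun rho : nreal => rho : V -> C * C)
    (fun rho : nreal => g rho : V -> C * C) m [set: V] (edges G).
  split.
  - exact: nreal_partial_real.
  - by move=> rho; apply: nreal_partial_real.
  - move=> rho [r1 r2 rE].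
    have hr : compatible G lam (finfun rho) && normalized v1 v2 (finfun rho).
      rewrite /normalized !ffunE r1 r2 !eqxx !andbT.
      apply/forallP => u; apply/forallP => v; apply/implyP => /rE ->.
      by rewrite !ffunE.
    by exists (NReal hr) => v _; rewrite /= ffunE.
  - move=> x y gxy v _; suff -> : x = y by [].
    by apply: (bij_inj g_bij); apply/val_inj/ffunP => u; apply: gxy.
  - by move=> x y i j k; apply: g_area.
have [Phi [hPhi PhiK Phi_pt _]] := family_field_graph lam_generic hG (subxx _) fam.
have ex_img (x : extE) : exists y : extE, Phi (genfield_val x) (genfield_val y).
  by apply: (extE_field_graph hPhi) => // rho v; exists (g rho); apply: Phi_pt.
have ex_pre (y : extE) : exists x : extE, Phi (genfield_val x) (genfield_val y).
  apply: (extE_field_graph (field_graph_sym hPhi)) => // rho v; exists (h rho).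
  by have := Phi_pt (h rho) v (in_setT v); rewrite hg.
have [f hf] := boolp.choice ex_img; have [f' hf'] := boolp.choice ex_pre.
(* [f] comes from choice, but [Phi] is single-valued, so the morphism laws of [f] follow from those
   of [Phi]. *)
have f_uniq x y : Phi (genfield_val x) (genfield_val y) -> f x = y.
  by move=> hxy; apply: val_inj; apply: fgraph_fun (hf x) hxy.
have [] := @gal_of_fun C V G v1 v2 lam f.
- by move=> x y; apply: f_uniq; apply: (fgraphB hPhi (hf x) (hf y)).
- by apply: f_uniq; apply: (fgraph1 hPhi).
- by move=> x y; apply: f_uniq; apply: (fgraphM hPhi (hf x) (hf y)).
- exists f' => x; last by apply: f_uniq; apply: hf'.
  by apply: val_inj; apply: fgraph_inj (hf' (f x)) (hf x).
- by move=> x xK; apply: f_uniq; apply: PhiK.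
move=> s sf; exists s => rho; apply/val_inj/ffunP => v.
have [h1 h2] := Phi_pt rho v (in_setT v).
rewrite /= /gal_act_fun ffunE [RHS]surjective_pairing !sf.
by rewrite (f_uniq _ (coord1 (g rho) v)) // (f_uniq _ (coord2 (g rho) v)).
Qed.

End Realize.

(** The first three clauses make the action an injective homomorphism into the symmetric group; the
    last identifies its image. Together they give the isomorphism of permutation groups. *)
Theorem theorem3 (R : realType) (V : finType) (n : nat) (G : graph V)
    (v1 v2 : V) (m : (n - 2).-tuple (V * V * V)) (lam : {set V} -> R[i]) :
  #|V| = n ->
  minimally_rigid G ->
  henneberg1 v1 v2 m [set: V] (edges G) ->
  generic_labelling G v1 v2 lam ->
  [/\ forall s : gal G v1 v2 lam, bijective (gal_act s),
      forall s t : gal G v1 v2 lam,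
        gal_act (gal_comp s t) =1 gal_act s \o gal_act t,
      forall s t : gal G v1 v2 lam, gal_act s =1 gal_act t -> s =1 t
    & forall g : nreal G v1 v2 lam -> nreal G v1 v2 lam,
        (exists s : gal G v1 v2 lam, gal_act s =1 g) <->
        bijective g /\
        forall (l : 'I_(n - 2)) (rho rho' : nreal G v1 v2 lam),
          let: (i, j, k) := tnth m l in
          area i j k rho = area i j k rho' ->
          area i j k (g rho) = area i j k (g rho')].
Proof.
move=> _ _ hG lam_generic; split.
- exact: gal_act_bij.
- exact: gal_act_comp.
- exact: gal_act_faithful.
move=> g; split=> [[s sg]|[g_bij g_area]].
  split; first exact: eq_bij (gal_act_bij s) _ sg.
  move=> l rho rho'; case: (tnth m l) => [[i j] k].
  have [f hf] := gal_act_area s i j k.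
  have [e1 e2] := hf rho; have [e1' e2'] := hf rho'.
  by rewrite -!sg e1 e1' e2 e2' => /val_inj ->.
apply: (gal_of_area_map lam_generic hG g_bij) => i j k rho rho' /tnthP[l el].
by have := g_area l rho rho'; rewrite -el.
Qed.
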